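(* Let $Q(n)$ be the number of $n$-quasigroups of order $4$ on the set $A=\{0,1,2,3\}$. Then there is a constant $c$ (independent of $n$) such that for every natural number $n\ge 1$, $$Q(n) \leq 2^{(n+c)2^{n-1}},$$ and the right-hand side equals $2^{2^{n+\log_2 n - 1 + o(1)}}$ as $n\to\infty$.
   Context: Let $A=\{0,1,2,3\}$. For a natural number $n$, an $n$-quasigroup (of order $4$) is a pair $(A,q)$ where $q:A^n\to A$ satisfies $q(c)\neq q(c')$ for all $c,c'\in A^n$ that differ in exactly one coordinate. $Q(n)$ denotes the number of different $n$-quasigroups $(A,q)$, i.e. the number of such maps $q$ (not up to equivalence). *)

(* Defs.v *)
From HB Require Import structures.
From mathcomp Require Import all_boot all_order all_algebra.
From mathcomp Require Import all_classical all_reals all_analysis.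

Set Implicit Arguments.
Unset Strict Implicit.
Unset Printing Implicit Defensive.

Import Order.TTheory GRing.Theory Num.Theory.
Import numFieldNormedType.Exports.

Local Open Scope ring_scope.

Definition differ_in_one (A : finType) (n : nat) (c c' : {ffun 'I_n -> A}) :
  bool := #|[set i : 'I_n | c i != c' i]| == 1%N.

Definition is_nquasigroup (A : finType) (n : nat)
    (q : {ffun {ffun 'I_n -> A} -> A}) : bool :=
  [forall c : {ffun 'I_n -> A}, forall c' : {ffun 'I_n -> A},
     differ_in_one c c' ==> (q c != q c')].

(* Finite functions are counted as maps, not up to equivalence. *)
Definition Q (n : nat) : nat :=
  #|[set q : {ffun {ffun 'I_n -> 'I_4} -> 'I_4} | is_nquasigroup q]|.

Definition log2 (R : realType) (x : R) : R := ln x / ln 2.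

(* Main.v *)
Require Import Defs.
From mathcomp Require Import all_boot all_order all_algebra.
From mathcomp Require Import all_classical all_reals all_analysis.
Import Order.TTheory GRing.Theory Num.Theory.
Import numFieldNormedType.Exports.

(** The first two layers [q (., 0)] and [q (., 1)] of an [m.+1]-quasigroup [q] of
    order 4 are [m]-quasigroups. Once they are fixed, two colours remain for the
    layer [2] at each point of [A^m], the layer [3] taking the other one. If
    two points of a line have a remaining colour in common, the choice at one of them
    forces the choice at the other. In every direction each point has such a
    neighbour, so the connected components have at least [2^m] points and there
    are at most [2^m] of them. Hence [Q m.+1 <= Q m ^ 2 * 2 ^ 2 ^ m], and
    iterating gives [Q n.+1 <= 2 ^ ((n + 5) * 2 ^ n)]. *)

(** * Points with one more coordinate, and points moved along a line *)

Section ExtendPoint.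
Context {A : finType} {m : nat}.
Implicit Types (x y : {ffun 'I_m -> A}) (a b : A) (i : 'I_m).

Definition extend x a : {ffun 'I_m.+1 -> A} :=
  [ffun j => if unlift ord0 j is Some i then x i else a].

Lemma extend0 x a : extend x a ord0 = a.
Proof. by rewrite ffunE unlift_none. Qed.

Lemma extend_lift x a i : extend x a (lift ord0 i) = x i.
Proof. by rewrite ffunE liftK. Qed.

Lemma extend_surj (c : {ffun 'I_m.+1 -> A}) : exists x a, c = extend x a.
Proof.
exists [ffun i => c (lift ord0 i)], (c ord0); apply/ffunP => j.
by case: (unliftP ord0 j) => [i|] ->; rewrite ?extend_lift ?extend0 ?ffunE.
Qed.

Lemma differ_in_one_extend x a b : a != b -> differ_in_one (extend x a) (extend x b).
Proof.
move=> neq_ab; apply/cards1P; exists ord0; apply/finset.setP => j; rewrite !inE.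
case: (unliftP ord0 j) => [i|] ->; last by rewrite !extend0 neq_ab eqxx.
by rewrite !extend_lift eqxx.
Qed.

Lemma differ_in_one_extendl x y a :
  differ_in_one x y -> differ_in_one (extend x a) (extend y a).
Proof.
case/cards1P => i /finset.setP xyP; apply/cards1P; exists (lift ord0 i).
apply/finset.setP => j; rewrite !inE; case: (unliftP ord0 j) => [k|] ->.
  by rewrite !extend_lift (inj_eq lift_inj); have:= xyP k; rewrite !inE.
by rewrite !extend0 eqxx (negPf (neq_lift _ _)).
Qed.

Lemma differ_in_one_sym n (c c' : {ffun 'I_n -> A}) :
  differ_in_one c c' = differ_in_one c' c.
Proof. by congr (#|pred_of_set _| == _); apply/finset.setP => i; rewrite !inE eq_sym. Qed.

Definition replace x i a : {ffun 'I_m -> A} := [ffun j => if j == i then a else x j].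

Lemma differ_in_one_replace x i a b :
  a != b -> differ_in_one (replace x i a) (replace x i b).
Proof.
move=> neq_ab; apply/cards1P; exists i; apply/finset.setP => j; rewrite !inE !ffunE.
by case: ifP => // _; rewrite eqxx.
Qed.

Lemma replace_id x i : replace x i (x i) = x.
Proof. by apply/ffunP => j; rewrite ffunE; case: eqP => [->|]. Qed.

End ExtendPoint.

(** * Lines and layers of a quasigroup *)

Section Quasigroup.
Context {A : finType} {n : nat}.
Implicit Type q : {ffun {ffun 'I_n -> A} -> A}.

Lemma nquasigroup_neq q : is_nquasigroup q ->
  forall c c', differ_in_one c c' -> q c != q c'.
Proof. by move=> /forallP qP c c'; have /forallP/(_ c')/implyP := qP c. Qed.

Lemma nquasigroup_line_surj q (x : {ffun 'I_n -> A}) (i : 'I_n) (a : A) :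
  is_nquasigroup q -> exists b, q (replace x i b) = a.
Proof.
move=> qP; have inj : injective (fun b => q (replace x i b)).
  move=> b b' /= /eqP eq_q; apply/eqP; apply: contraTT eq_q => neq_bb'.
  exact/(nquasigroup_neq q qP)/differ_in_one_replace.
by have /codomP[b ->] := injF_onto inj a; exists b.
Qed.

End Quasigroup.

Section Layer.
Context {A : finType} {m : nat}.
Implicit Type q : {ffun {ffun 'I_m.+1 -> A} -> A}.

Definition layer a q : {ffun {ffun 'I_m -> A} -> A} := [ffun x => q (extend x a)].

Lemma layer_inj q q' : (forall a, layer a q = layer a q') -> q = q'.
Proof.
move=> eq_qq'; apply/ffunP => c; have [x [a ->]] := extend_surj c.
by have /ffunP/(_ x) := eq_qq' a; rewrite !ffunE.
Qed.

Lemma layer_nquasigroup a q : is_nquasigroup q -> is_nquasigroup (layer a q).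
Proof.
move=> qP; apply/forallP => c; apply/forallP => c'; apply/implyP => cc'.
by rewrite !ffunE; apply/(nquasigroup_neq q qP)/differ_in_one_extendl.
Qed.

Lemma layer_column_inj q x : is_nquasigroup q -> injective (fun a => layer a q x).
Proof.
move=> qP a b /eqP; rewrite !ffunE => eq_q; apply/eqP; apply: contraTT eq_q => neq_ab.
exact/(nquasigroup_neq q qP)/differ_in_one_extend.
Qed.

Lemma layer_column_surj q x c : is_nquasigroup q -> exists a, layer a q x = c.
Proof.
by move=> qP; have /codomP[a ->] := injF_onto (layer_column_inj q x qP) c; exists a.
Qed.

End Layer.

(** * Sizes and number of connected components *)

(** Induction on the number [k] of free coordinates. Moving a point within [T] along coordinate [k]
    gives two disjoint sets, the points of [T] that agree with the old or with the moved point from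
    coordinate [k] on, so each step doubles the count. *)
Lemma card_closed_directions (A : finType) (m : nat) (T : {set {ffun 'I_m -> A}}) x :
  (forall y i, y \in T -> exists a, a != y i /\ replace y i a \in T) ->
  x \in T -> 2 ^ m <= #|T|.
Proof.
move=> closedT xT.
pose agree k (x : {ffun 'I_m -> A}) := [set y in T | [forall i : 'I_m, (k <= i) ==> (y i == x i)]].
have agree_card k : k <= m -> forall x, x \in T -> 2 ^ k <= #|agree k x|.
  elim: k => [|k IH] le_km {}x {}xT.
    by rewrite expn0 card_gt0; apply/finset.set0Pn; exists x; rewrite inE xT;
      apply/forallP => j; rewrite eqxx implybT.
  pose i := Ordinal le_km; have [a [neq_a yT]] := closedT x i xT.
  set y := replace x i a in yT.
  have disj : agree k x :&: agree k y = finset.set0.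
    apply/finset.setP => z; rewrite !inE; apply/negP.
    case/andP=> /andP[_ /forallP/(_ i)] /=; rewrite leqnn /= => /eqP zi.
    case/andP=> _ /forallP/(_ i) /=; rewrite leqnn ffunE eqxx zi /= => /eqP xa.
    by rewrite xa eqxx in neq_a.
  have sub : agree k x :|: agree k y \subset agree k.+1 x.
    apply/fintype.subsetP => z; rewrite 4!inE.
    case/orP; case/andP=> -> /forallP zP; apply/forallP => j; apply/implyP => lt_kj.
      by have := zP j; rewrite (ltnW lt_kj).
    have := zP j; rewrite (ltnW lt_kj) ffunE -val_eqE /=.
    by rewrite gtn_eqF.
  apply: leq_trans (subset_leq_card sub).
  rewrite cardsU disj cards0 subn0 expnS mul2n -addnn.
  by rewrite leq_add // IH // ltnW.
apply: leq_trans (agree_card m (leqnn m) x xT) _.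
by apply: subset_leq_card; apply/fintype.subsetP => z; rewrite inE => /andP[].
Qed.

(** The components partition [T], one for each root, and each contributes at least [k] points. *)
Lemma card_roots_leq {T : finType} (e : rel T) k :
  fingraph.connect_sym e -> (forall x, k <= #|connect e x|) ->
  #|fingraph.roots e| * k <= #|T|.
Proof.
move=> sym_e le_k; rewrite -[#|T|]sum1_card (partition_big (fingraph.root e) (fingraph.roots e)) /=.
  rewrite -sum_nat_const; apply: leq_sum => r r_root.
  rewrite sum1_card; apply: leq_trans (le_k r) _; apply: subset_leq_card.
  apply/fintype.subsetP => x; rewrite !inE unfold_in /= => rx.
  by apply/eqP; rewrite -(fingraph.rootP sym_e rx); apply/eqP.
by move=> x _; apply: roots_root.
Qed.

(** * Quasigroups with prescribed layers 0 and 1 *)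

Section Completions.
Context {m : nat}.
Local Notation point := {ffun 'I_m -> 'I_4}.
Local Notation layer k q := (layer (inord k : 'I_4) q).

Implicit Types (f g : {ffun point -> 'I_4}) (x y : point).

Lemma ord4P (a : 'I_4) : [\/ a = inord 0, a = inord 1, a = inord 2 | a = inord 3].
Proof.
by case: a => [[|[|[|[|a]]]]] // lt_a;
  [constructor 1|constructor 2|constructor 3|constructor 4];
  apply/val_inj; rewrite /= inordK.
Qed.

(* [x] and [y] lie on a line and share a colour unused by [f] and [g] at both. *)
Definition linked f g : rel point := fun x y =>
  differ_in_one x y && [exists c, c \notin [:: f x; g x; f y; g y]].

Lemma linked_sym f g : symmetric (linked f g).
Proof.
move=> x y; rewrite /linked differ_in_one_sym; congr andb.
apply: eq_existsb => c; rewrite !inE.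
by case: (c == f x) (c == g x) (c == f y) (c == g y) => [] [] [] [].
Qed.

Definition completions f g :=
  [set q | [&& is_nquasigroup q, layer 0 q == f & layer 1 q == g]].

Lemma remaining_colour q x c : is_nquasigroup q ->
  c != layer 0 q x -> c != layer 1 q x -> c = layer 2 q x \/ c = layer 3 q x.
Proof.
move=> qP c0 c1; have [a eq_c] := layer_column_surj q x c qP; subst c.
by case: (ord4P a) c0 c1 => ->; rewrite ?eqxx //; auto.
Qed.

(** The bounds keep distinct indices distinct: [inord] sends every number from 4 on to 0. *)
Lemma layer_neq q x k l : is_nquasigroup q -> k < 4 -> l < 4 -> k != l ->
  layer k q x != layer l q x.
Proof.
move=> qP k4 l4; apply: contraNneq => /(layer_column_inj q x qP)/(congr1 val) /=.
by rewrite !inordK // => ->.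
Qed.

(** Layers 0 and 1 are common to both, so layer 2 of [q'] takes at [x] one of the two colours that
    [q] has there in layers 2 and 3. *)
Lemma completions_agree_or_swap f g q q' x :
  q \in completions f g -> q' \in completions f g ->
  layer 2 q x != layer 2 q' x ->
  layer 2 q' x = layer 3 q x.
Proof.
rewrite !inE => /and3P[qP /eqP q0 /eqP q1] /and3P[q'P /eqP q'0 /eqP q'1] neq.
have [||eq2|//] := remaining_colour q x (layer 2 q' x) qP.
- by rewrite q0 -q'0 layer_neq.
- by rewrite q1 -q'1 layer_neq.
by rewrite eq2 eqxx in neq.
Qed.

(** The shared colour [c] lies in layer 2 or 3 of each completion, and not in the same layer at [x]
    and [y], since each layer is a quasigroup. Completions that agree at [x] have [c] in the same
    layer there, hence also at [y]; a swap at [y] contradicts this. *)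
Lemma linked_agree f g q q' x y :
  q \in completions f g -> q' \in completions f g -> linked f g x y ->
  layer 2 q x = layer 2 q' x -> layer 2 q y = layer 2 q' y.
Proof.
move=> qC q'C /andP[dxy /existsP[c]]; rewrite !inE !negb_or => /and4P[cx0 cx1 cy0 cy1] eq2.
apply/eqP; apply/negPn/negP => neq.
have swap := completions_agree_or_swap _ _ _ _ _ qC q'C neq.
have swap' : layer 2 q y = layer 3 q' y.
  by apply: completions_agree_or_swap q'C qC _; rewrite eq_sym.
move: qC q'C; rewrite !inE => /and3P[qP /eqP q0 /eqP q1] /and3P[q'P /eqP q'0 /eqP q'1].
have adj k p : is_nquasigroup p -> layer k p x != layer k p y.
  by move=> pP; apply: nquasigroup_neq (layer_nquasigroup _ p pP) _ _ dxy.
have cx : c = layer 2 q x \/ c = layer 3 q x by apply: remaining_colour; rewrite ?q0 ?q1.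
have cx' : c = layer 2 q' x \/ c = layer 3 q' x.
  by apply: remaining_colour; rewrite ?q'0 ?q'1.
have cy : c = layer 2 q y \/ c = layer 3 q y by apply: remaining_colour; rewrite ?q0 ?q1.
have nq := layer_neq q x 2 3 qP isT isT isT.
have nq' := layer_neq q' x 2 3 q'P isT isT isT.
have := adj 2 q qP; have := adj 3 q qP; have := adj 2 q' q'P; have := adj 3 q' q'P.
rewrite -swap' swap -eq2; rewrite -eq2 in cx' nq'.
case: cx => cx; case: cy => cy; rewrite -?cx -?cy ?eqxx //.
(* The case left has [c] in layer 3 of [q] at [x] and in layer 2 at [y]. By the swap, layer 3 of
   [q'] has [c] at [y], so it cannot have it at [x]. *)
by case: cx' => cx'; [rewrite -cx -cx' eqxx in nq | rewrite -cx' eqxx].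
Qed.

Lemma connect_agree f g q q' x y :
  q \in completions f g -> q' \in completions f g -> connect (linked f g) x y ->
  layer 2 q x = layer 2 q' x -> layer 2 q y = layer 2 q' y.
Proof.
move=> qC q'C /connectP[p]; elim: p x => [|z p IH] x /= => [_ -> //|].
case/andP=> xz pz eq_y eq_x; apply: IH pz eq_y _.
exact: linked_agree qC q'C xz eq_x.
Qed.

Lemma linked_directions f g q x i : q \in completions f g ->
  exists2 a, a != x i & linked f g x (replace x i a).
Proof.
rewrite inE => /and3P[qP /eqP q0 /eqP q1].
have [a eq_a] :=
  nquasigroup_line_surj _ x i (layer 2 q x) (layer_nquasigroup (inord 3) q qP).
exists a.
  apply: contraTneq (layer_neq q x 3 2 qP isT isT isT) => a_xi.
  by rewrite -eq_a a_xi replace_id eqxx.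
apply/andP; split.
  rewrite -{1}(replace_id x i) differ_in_one_replace //.
  apply: contraTneq (layer_neq q x 3 2 qP isT isT isT) => xi_a.
  by rewrite -eq_a -xi_a replace_id eqxx.
apply/existsP; exists (layer 2 q x); rewrite !inE !negb_or -q0 -q1.
by rewrite -{3 4}eq_a !layer_neq.
Qed.

(** Relative to a fixed completion [q0], a completion is determined by the set of component roots at
    which its layer 2 agrees with that of [q0]. So completions inject into the subsets of the set of
    roots. *)
Lemma card_completions_leq f g : #|completions f g| <= 2 ^ 2 ^ m.
Proof.
have [->|/finset.set0Pn[q0 q0C]] := eqVneq (completions f g) finset.set0; first by rewrite cards0.
have sym_e := fingraph.sym_connect_sym (linked_sym f g).
have roots_le : #|fingraph.roots (linked f g)| <= 2 ^ m.
  (* It suffices that the number of roots times the least component size [2 ^ m] is at most [4 ^ m],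
     the number of points. *)
  rewrite -(leq_pmul2r (expn_gt0 2 m)) -expnMn.
  have -> : (2 * 2) ^ m = #|{: point}| by rewrite card_ffun !card_ord.
  apply: card_roots_leq => // x.
  rewrite -(cardsE (connect (linked f g) x)).
  apply: (card_closed_directions _ _ _ x); last by rewrite inE; apply: connect0.
  move=> y i; rewrite inE => xy; have [a neq_a ya] := linked_directions f g q0 y i q0C.
  by exists a; rewrite neq_a inE; split=> //; apply: fingraph.connect_trans xy (connect1 ya).
pose agree q := [set r in fingraph.roots (linked f g) | layer 2 q r == layer 2 q0 r].
have agree_inj : {in completions f g &, injective agree}.
  move=> q q' qC q'C /finset.setP eq_agree.
  have eq2 x : layer 2 q x = layer 2 q' x.
    apply: (connect_agree f g q q' (fingraph.root (linked f g) x)) => //.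
      by rewrite sym_e connect_root.
    set r := fingraph.root _ x.
    have:= eq_agree r; rewrite !inE (roots_root sym_e) /=.
    case: (eqVneq (layer 2 q r)) => [-> /esym/eqP -> //|neq /esym/negbT neq'].
    (* Two completions that both differ from [q0] at the root have there the colour of layer 3 of
       [q0]. *)
    rewrite eq_sym in neq; rewrite eq_sym in neq'.
    by rewrite (completions_agree_or_swap f g q0 q r) // (completions_agree_or_swap f g q0 q' r).
  move: (qC) (q'C); rewrite !inE => /and3P[qP /eqP ql0 /eqP ql1] /and3P[q'P /eqP q'l0 /eqP q'l1].
  apply: layer_inj => a; apply/ffunP => x.
  case: (ord4P a) => ->; rewrite ?ql0 ?ql1 ?q'l0 ?q'l1 //.
  have [||h|//] := remaining_colour q' x (layer 3 q x) q'P.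
  - by rewrite q'l0 -ql0 layer_neq.
  - by rewrite q'l1 -ql1 layer_neq.
  by have := layer_neq q x 3 2 qP isT isT isT; rewrite h eq2 eqxx.
rewrite -(card_in_imset agree_inj).
apply: leq_trans (_ : #|powerset [set r in fingraph.roots (linked f g)]| <= _).
  apply: subset_leq_card; apply/fintype.subsetP => _ /imsetP[q _ ->].
  by rewrite inE; apply/fintype.subsetP => r; rewrite !inE => /andP[].
by rewrite card_powerset cardsE leq_exp2l.
Qed.

End Completions.

(** * The recurrence and its solution *)

Lemma Q_recurrence m : Q m.+1 <= Q m ^ 2 * 2 ^ 2 ^ m.
Proof.
rewrite /Q -sum1_card.
set S := [set q : {ffun {ffun 'I_m -> 'I_4} -> 'I_4} | is_nquasigroup q].
rewrite (partition_big (fun q => (layer (inord 0) q, layer (inord 1) q)) (mem (finset.setX S S))) /=.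
  rewrite expnS expn1 -cardsX -sum_nat_const; apply: leq_sum => -[f g] _.
  apply: leq_trans (card_completions_leq f g); rewrite sum1_card.
  apply: subset_leq_card; apply/fintype.subsetP => q.
  by rewrite unfold_in /= !inE xpair_eqE.
by move=> q; rewrite !inE => qP; rewrite !layer_nquasigroup.
Qed.

Lemma Q_leq n : Q n.+1 <= 2 ^ ((n + 5) * 2 ^ n).
Proof.
elim: n => [|n IH].
  have Q0 : Q 0 <= 4.
    by apply: leq_trans (max_card _) _; rewrite !card_ffun !card_ord.
  apply: leq_trans (Q_recurrence 0) _.
  (* The constant 5 comes from here: [4 ^ 2 * 2 = 2 ^ 5]. *)
  apply: leq_trans (_ : 4 ^ 2 * 2 ^ 2 ^ 0 <= _) => //.
  by rewrite leq_mul2r leq_exp2r // Q0 orbT.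
apply: leq_trans (Q_recurrence _) _.
apply: leq_trans (_ : (2 ^ ((n + 5) * 2 ^ n)) ^ 2 * 2 ^ 2 ^ n.+1 <= _).
  by rewrite leq_mul2r leq_exp2r // IH orbT.
(* Squaring turns [2 ^ n] into [2 ^ n.+1] in the exponent, and the extra summand [2 ^ n.+1] raises
   [n + 5] by one. *)
rewrite -expnM -expnD leq_exp2l // addSn mulSn addnC leq_add2l expnS.
by rewrite [2 * _]mulnC mulnA.
Qed.

(** * The real bound and its asymptotic form *)

Local Open Scope classical_set_scope.
Local Open Scope ring_scope.

Lemma cvg_log2_shift (R : realType) (c : R) :
  log2 (1 + c / n%:R) @[n --> \oo] --> (0 : R).
Proof.
have inv0 : (n%:R^-1 : R) @[n --> \oo] --> (0 : R).
  apply/gtr0_cvgV0; last exact: cvgr_idn.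
  by near=> n; rewrite ltr0n; near: n; exists 1%N.
have cvg1 : (1 + c / n%:R : R) @[n --> \oo] --> (1 : R).
  rewrite -[X in _ --> X]addr0 -(mulr0 c).
  by apply: cvgD; [exact: cvg_cst|apply: cvgMr].
rewrite -[X in _ --> X](mul0r (ln 2)^-1) -(@ln1 R).
apply: cvgMl.
by apply: (cvg_comp _ _ cvg1); apply: continuous_ln.
Unshelve. all: end_near.
Qed.

Theorem mainTheorem5 (R : realType) :
  exists c : R,
    (forall n : nat, (1 <= n)%N ->
       (Q n)%:R <= 2 `^ ((n%:R + c) * 2 ^+ n.-1)) /\
    (exists eps : nat -> R,
       eps @ \oo --> (0 : R) /\
       forall n : nat, (1 <= n)%N ->
         2 `^ ((n%:R + c) * 2 ^+ n.-1) =
         2 `^ (2 `^ (n%:R + log2 (n%:R : R) - 1 + eps n))).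
Proof.
(* The shift of index in [Q_leq] gives 4: [n + 5 = n.+1 + 4]. *)
exists 4%:R; split=> [[//|n] _|].
  have -> : (n.+1%:R + 4%:R) * 2 ^+ n.+1.-1 = ((n + 5) * 2 ^ n)%:R :> R.
    by rewrite -natrD natrM natrX addSnnS.
  by rewrite powR_mulrn // -natrX ler_nat Q_leq.
(* For positive [n], the factor [n + 4] is [n * (1 + 4 / n)]; the logarithm of the second factor is
   the error term. *)
exists (fun n => log2 (1 + 4%:R / n%:R)); split; first exact: cvg_log2_shift.
case=> [//|n] _; congr (_ `^ _).
have two0 : (2 : R) != 0 by rewrite pnatr_eq0.
have ln2 : ln 2 != 0 :> R by rewrite gt_eqF // ln_gt0 // ltr1n.
have powlog (x : R) : 0 < x -> 2 `^ log2 x = x.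
  by move=> x0; rewrite /powR (negPf two0) /log2 divfK // lnK.
have n0 : 0 < n.+1%:R :> R by rewrite ltr0n.
have -> : n.+1%:R + log2 n.+1%:R - 1 + log2 (1 + 4%:R / n.+1%:R) =
   n%:R + (log2 (n.+1%:R : R) + log2 (1 + 4%:R / n.+1%:R)) :> R.
  by rewrite addrA [n.+1%:R + _ - 1]addrAC -[X in X - 1]natr1 addrK.
rewrite !powRD ?two0 ?implybT // powR_mulrn // !powlog //.
by rewrite [RHS]mulrC mulrDr mulr1 mulrCA divff ?gt_eqF // mulr1.
Qed.
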